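(* Let $n\geq 3$ be an integer and $J$ a $\phi_n$-injective, weakly connected quiver. If $J$ has a walk of length $n-1$, then $J$ is a blow-up of $C_\ell$ for some positive integer $\ell$ dividing $n$.
   Context: A quiver is a quadruple $(V,E,\sigma,\tau)$ with $V,E$ sets and $\sigma,\tau:E\to V$ functions (source and target); an edge $e$ goes from $\sigma(e)$ to $\tau(e)$; quiver homomorphisms are pairs of vertex and edge maps commuting with sources and targets. For $v,w\in V(J)$, $\mathrm{edges}_J(v,w):=\sigma_J^{-1}(v)\cap\tau_J^{-1}(w)$. A walk of length $k$ is a sequence of vertices $v_1,\dots,v_{k+1}$ with edges $e_i\in\mathrm{edges}_J(v_i,v_{i+1})$. $J$ is weakly connected if any two vertices are joined by a finite sequence of edges, each traversed in either direction. For $m\geq 1$, the directed cycle $C_m$ has vertices $a_1,\dots,a_m$ and edges $x_1,\dots,x_m$ with $x_k$ from $a_k$ to $a_{k+1}$ (indices mod $m$); in particular $C_1$ is a single vertex with a single loop. The directed path $P_n$ has vertices $a_1,\dots,a_n$ and edges $x_1,\dots,x_{n-1}$ with $x_k$ from $a_k$ to $a_{k+1}$, and $\phi_n:P_n\to C_n$ is the inclusion. $J$ is $\phi_n$-injective if for every quiver homomorphism $\psi:P_n\to J$ there is a quiver homomorphism $\hat\psi:C_n\to J$ with $\hat\psi\circ\phi_n=\psi$. A blow-up of a quiver $G$ is a quiver $H$ equipped with partitions (families of pairwise disjoint subsets with union the whole set) $(A_v)_{v\in V(G)}$ of $V(H)$ and $(B_e)_{e\in E(G)}$ of $E(H)$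 such that for all $e\in E(G)$, $f\in B_e$, $x\in A_{\sigma_G(e)}$, $y\in A_{\tau_G(e)}$: $\sigma_H(f)\in A_{\sigma_G(e)}$, $\tau_H(f)\in A_{\tau_G(e)}$, and $\mathrm{edges}_H(x,y)\cap B_e\neq\emptyset$. *)

(* Defs.v *)
From Stdlib Require Import Relations.
From mathcomp Require Import all_boot.
From mathcomp Require Import boolp classical_sets.

Set Implicit Arguments.
Unset Strict Implicit.
Unset Printing Implicit Defensive.

Local Open Scope classical_set_scope.

Record quiver := Quiver {
  vert : Type;
  edge : Type;
  src : edge -> vert;
  tgt : edge -> vert
}.
Arguments src {q} e : rename.
Arguments tgt {q} e : rename.

Record qhom (G H : quiver) := QHom {
  vmap : vert G -> vert H;
  emap : edge G -> edge H;
  qhom_src : forall e, src (emap e) = vmap (src e);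
  qhom_tgt : forall e, tgt (emap e) = vmap (tgt e)
}.

(* Equality of homomorphisms is equality of both underlying maps. *)
Definition qhom_eq (G H : quiver) (f g : qhom G H) : Prop :=
  vmap f =1 vmap g /\ emap f =1 emap g.

Lemma qhom_comp_src (G H K : quiver) (g : qhom H K) (f : qhom G H) e :
  src ((emap g \o emap f) e) = (vmap g \o vmap f) (src e).
Proof. by rewrite /= !qhom_src. Qed.

Lemma qhom_comp_tgt (G H K : quiver) (g : qhom H K) (f : qhom G H) e :
  tgt ((emap g \o emap f) e) = (vmap g \o vmap f) (tgt e).
Proof. by rewrite /= !qhom_tgt. Qed.

Definition qhom_comp (G H K : quiver) (g : qhom H K) (f : qhom G H) :
    qhom G K :=
  QHom (qhom_comp_src g f) (qhom_comp_tgt g f).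

Definition edges (J : quiver) (v w : vert J) : set (edge J) :=
  src @^-1` [set v] `&` tgt @^-1` [set w].

Definition has_walk (J : quiver) (k : nat) : Prop :=
  exists (v : 'I_k.+1 -> vert J) (e : 'I_k -> edge J),
    forall i : 'I_k, edges (v (widen_ord (leqnSn k) i)) (v (lift ord0 i)) (e i).

Definition weak_adj (J : quiver) (v w : vert J) : Prop :=
  exists e : edge J, edges v w e \/ edges w v e.

Definition weakly_connected (J : quiver) : Prop :=
  forall v w : vert J, clos_refl_trans (vert J) (@weak_adj J) v w.

(* Vertices and edges are numbered from 0: ordS is i |-> i.+1 %% m.
   The directed cycle is only meaningful for m >= 1. *)
Definition dicycle (m : nat) : quiver :=
  @Quiver 'I_m 'I_m id (@ordS m).

Lemma dipath_tgt_subproof (n : nat) (i : 'I_n.-1) : i.+1 < n.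
Proof. by case: n i => [|n] [i]. Qed.

Definition dipath (n : nat) : quiver :=
  @Quiver 'I_n 'I_n.-1 (widen_ord (leq_pred n))
    (fun i => Ordinal (dipath_tgt_subproof i)).

Lemma phi_src (n : nat) (e : edge (dipath n)) :
  @src (dicycle n) (widen_ord (leq_pred n) e) = src e.
Proof. by []. Qed.

Lemma phi_tgt (n : nat) (e : edge (dipath n)) :
  @tgt (dicycle n) (widen_ord (leq_pred n) e) = tgt e.
Proof. by apply: val_inj; rewrite /= modn_small ?dipath_tgt_subproof. Qed.

Definition phi (n : nat) : qhom (dipath n) (dicycle n) :=
  @QHom (dipath n) (dicycle n) id (widen_ord (leq_pred n))
    (@phi_src n) (@phi_tgt n).

Definition phi_injective (n : nat) (J : quiver) : Prop :=
  forall psi : qhom (dipath n) J,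
    exists psi_hat : qhom (dicycle n) J, qhom_eq (qhom_comp psi_hat (phi n)) psi.

(* Parts may be empty, unlike in classical_sets.partition. *)
Definition set_partition (I T : Type) (A : I -> set T) : Prop :=
  trivIset setT A /\ \bigcup_i A i = setT.

(* Each condition quantifies only over the variables it mentions: since parts
   may be empty, one joint quantification over f, x and y would make all the
   conditions at e vacuous as soon as B e, A (src e) or A (tgt e) is empty. *)
Definition is_blowup (G H : quiver) : Prop :=
  exists (A : vert G -> set (vert H)) (B : edge G -> set (edge H)),
    [/\ set_partition A,
        set_partition B,
        forall (e : edge G) (f : edge H),
          B e f -> A (src e) (src f) /\ A (tgt e) (tgt f) &
        forall (e : edge G) (x y : vert H),
          A (src e) x -> A (tgt e) y -> edges x y `&` B e !=set0].

(* Main.v *)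
Require Import Defs.
From Stdlib Require Import Relations.
From mathcomp Require Import all_boot.
From mathcomp Require Import boolp classical_sets zify.

(** Let [E] be the adjacency relation of [J]. Injectivity says that [E^(n-1)]
    is contained in the converse of [E]. A closed walk of length [n] through
    [x] can be rerouted through any neighbour of [x], so by connectivity [E^n]
    is reflexive, and the rerouting also shows [E^(n-1)] to be equal to the
    converse of [E]. Hence [E = E^((n-1)^2)], which contains [E^(n+1)], and the
    positive powers of [E] only depend on the exponent modulo [n]. Fixing a
    vertex [o], the exponents [k] with [E^k o o] are the multiples of some
    [l %| n], and the parts of the blow-up are the sets of vertices at a given
    distance from [o] modulo [l]. *)

Set Implicit Arguments.
Unset Strict Implicit.
Unset Printing Implicit Defensive.

(** * Powers of a relation *)

Fixpoint relpow (T : Type) (E : T -> T -> Prop) (k : nat) (x y : T) : Prop :=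
  if k is k'.+1 then exists2 z, E x z & relpow E k' z y else x = y.

Lemma relpow1 (T : Type) (E : T -> T -> Prop) x y : relpow E 1 x y <-> E x y.
Proof. by split=> [[z Exz <-]|Exy] //; exists y. Qed.

Lemma relpowD (T : Type) (E : T -> T -> Prop) a b x y :
  relpow E (a + b) x y <-> exists2 z, relpow E a x z & relpow E b z y.
Proof.
elim: a x => [|a IH] x /=; first by split=> [?|[z ->]] //; exists x.
split=> [[w Exw /IH[z wz zy]]|[z [w Exw wz] zy]].
  by exists z => //; exists w.
by exists w => //; apply/IH; exists z.
Qed.

Lemma relpow_cat (T : Type) (E : T -> T -> Prop) a b x y z :
  relpow E a x y -> relpow E b y z -> relpow E (a + b) x z.
Proof. by move=> xy yz; apply/relpowD; exists y. Qed.

Lemma relpow_mono (T : Type) (E F : T -> T -> Prop) k x y :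
  (forall u v, E u v -> F u v) -> relpow E k x y -> relpow F k x y.
Proof.
move=> EF; elim: k x => [|k IH] x //= [z /EF Fxz /IH zy].
by exists z.
Qed.

Lemma relpowM (T : Type) (E : T -> T -> Prop) a b x y :
  relpow (relpow E a) b x y <-> relpow E (b * a) x y.
Proof.
elim: b x => [|b IH] x //=; rewrite mulSn.
split=> [[z xz /IH zy]|/relpowD[z xz /IH zy]]; last by exists z.
exact: relpow_cat xz zy.
Qed.

Lemma relpow_flip (T : Type) (E : T -> T -> Prop) k x y :
  relpow E k x y -> relpow (fun u v => E v u) k y x.
Proof.
elim: k x => [|k IH] x; first by move=> ->.
case=> z Exz /IH yz; rewrite -addn1.
by apply: relpow_cat yz _; apply/relpow1.
Qed.

Lemma relpow_loop (T : Type) (E : T -> T -> Prop) k t x :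
  relpow E k x x -> relpow E (t * k) x x.
Proof.
move=> xx; elim: t => [|t IH] //; rewrite mulSn; exact: relpow_cat xx IH.
Qed.

Lemma relpowP (T : Type) (E : T -> T -> Prop) k x y :
  relpow E k x y <->
  exists v : nat -> T, [/\ v 0 = x, v k = y &
                           forall i, i < k -> E (v i) (v i.+1)].
Proof.
split; last first.
  case=> v [<- <-]; elim: k v => [|k IH] v Ev //=.
  by exists (v 1); [exact: Ev | apply: (IH (v \o succn)) => i ik; apply: Ev].
elim: k x => [|k IH] x /=; first by move=> ->; exists (fun=> y).
case=> z Exz /IH[v [v0 vk Ev]].
exists (fun i => if i is j.+1 then v j else x); split=> // -[|i] ik.
  by rewrite v0.
exact: Ev.
Qed.

(** * Relations in which every walk of length [n - 1] closes up *)

Section ClosingRelation.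

Context (T : Type) (E : T -> T -> Prop) (n : nat).
Context (n_ge3 : 3 <= n).
Context (E_close : forall x y, relpow E n.-1 x y -> E y x).

(** Let [z] be two steps after [x] on the closed walk. The [n - 2] steps from [z] to [x] followed by
    the edge to [y] close up to an edge from [y] to [z], which replaces the first two steps. *)
Lemma reroute_out x y : relpow E n x x -> E x y -> relpow E n.-1 y x.
Proof using n_ge3 E_close.
have -> : n = 2 + n.-2 by lia.
case/relpowD=> z _ zx /relpow1 xy.
have yz : E y z.
  by apply: E_close; have -> : n.-1 = n.-2 + 1 by [lia]; apply: relpow_cat zx xy.
by rewrite (_ : (2 + n.-2).-1 = n.-2.+1) //; exists z.
Qed.

(** The mirror image, with [z] two steps before [x]. *)
Lemma reroute_in x y : relpow E n x x -> E y x -> relpow E n.-1 x y.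
Proof using n_ge3 E_close.
have -> : n = n.-2 + 2 by lia.
case/relpowD=> z xz _ yx.
have zy : E z y.
  by apply: E_close; have -> : n.-1 = n.-2.+1 by [lia]; exists x.
have -> : (n.-2 + 2).-1 = n.-2 + 1 by lia.
by apply: relpow_cat xz _; apply/relpow1.
Qed.

Context (E_conn : forall x y,
  clos_refl_trans T (fun u v => E u v \/ E v u) x y).
Context (o : T) (o_loop : relpow E n o o).

Lemma relpow_n_refl x : relpow E n x x.
Proof using n_ge3 E_close E_conn o_loop.
have n1 : n = n.-1.+1 by lia.
elim: (E_conn o x) o_loop => {x} [x y xy|x|x y z _ IH1 _ IH2] xx //; last first.
  exact/IH2/IH1.
case: xy => [xy|yx]; last by rewrite n1; exists x => //; apply: reroute_in.
rewrite n1 -addn1; apply: relpow_cat; first exact: reroute_out xy.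
exact/relpow1.
Qed.

Lemma relpow_inv k x y : relpow E k x y -> relpow E (k * n.-1) y x.
Proof using n_ge3 E_close E_conn o_loop.
move=> xy; apply/relpowM; apply: relpow_mono (relpow_flip xy) => u v vu.
by apply: reroute_out vu; apply: relpow_n_refl.
Qed.

(** Each block of [n - 1] steps closes to a reversed edge; these [n - 1] edges form a walk from [y]
    to [x], which closes in turn. *)
Lemma relpow_sqr_sub x y : relpow E (n.-1 * n.-1) x y -> E x y.
Proof using E_close.
move=> /relpowM xy; apply: E_close.
by apply: (relpow_flip (E := fun u v => E v u)); apply: relpow_mono xy.
Qed.

Lemma relpow_n1_sub x y : relpow E n.+1 x y -> E x y.
Proof using n_ge3 E_close E_conn o_loop.
move=> xy; apply: relpow_sqr_sub.
(* Prepending [n - 3] closed walks at [x] pads the length to [(n - 1)^2]. *)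
have -> : n.-1 * n.-1 = (n - 3) * n + n.+1 by nia.
by apply: relpow_cat xy; apply/relpow_loop/relpow_n_refl.
Qed.

(** The first [n + 1] steps shrink to one edge, [t] times over. For [k = 0] the conclusion would be
    [x = y], hence [0 < k]. *)
Lemma relpow_mod k t x y : 0 < k -> relpow E (k + t * n) x y -> relpow E k x y.
Proof using n_ge3 E_close E_conn o_loop.
case: k => // k _; elim: t => [|t IH]; first by rewrite addn0.
have -> : k.+1 + t.+1 * n = n.+1 + (k + t * n) by lia.
case/relpowD=> z /relpow_n1_sub xz zy; apply: IH.
by exists z.
Qed.

Lemma relpow_reach x : exists k, relpow E k o x.
Proof using n_ge3 E_close E_conn o_loop.
elim: (E_conn o x) => {x} [x y [xy|yx]|x|x y z _ [a xy] _ [b yz]].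
- by exists 1; apply/relpow1.
- by exists (1 * n.-1); apply/relpow_inv/relpow1.
- by exists 0.
- by exists (a + b); apply: relpow_cat xy yz.
Qed.

Lemma period_exists :
  exists l, [/\ 0 < l, l %| n & forall k, relpow E k o o <-> l %| k].
Proof using n_ge3 E_close E_conn o_loop.
have [|l /andP[l0 /asboolP ol] lmin] :=
  @ex_minnP (fun l => (0 < l) && `[< relpow E l o o >]).
  by exists n; apply/andP; split; [lia | apply/asboolP].
have P k : relpow E k o o <-> l %| k.
  split=> [ok|/dvdnP[t ->]]; last exact: relpow_loop.
  rewrite /dvdn; case: posnP => // r0.
  suff /asboolP or : relpow E (k %% l) o o.
    have /lmin : (0 < k %% l) && `[< relpow E (k %% l) o o >] by rewrite r0.
    by rewrite leqNgt ltn_pmod.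
  (* Modulo [n], removing [k %/ l * l] steps is the same as adding [n - 1] times as many. *)
  apply: (@relpow_mod _ (k %/ l * l)) => //.
  have -> : k %% l + k %/ l * l * n = k + k %/ l * l * n.-1.
    rewrite [X in _ = X + _](divn_eq k l).
    by rewrite -[n in LHS]prednK ?mulnS; lia.
  by apply: relpow_cat ok _; apply/relpow_inv/relpow_loop.
by exists l; split=> //; apply/P.
Qed.

Context (l : nat) (l_dvd : l %| n).
Context (l_period : forall k, relpow E k o o <-> l %| k).

(** Going out in [a] steps and back in [b * (n - 1)] is a closed walk at [o], of length congruent to
    [a - b] modulo [l] because [l %| n]. *)
Lemma relpow_uniq_mod a b x :
  relpow E a o x -> relpow E b o x -> a = b %[mod l].
Proof using n_ge3 E_close E_conn o_loop l_dvd l_period.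
move=> oa /relpow_inv xo; have /l_period := relpow_cat oa xo => dv.
apply/eqP; rewrite -(eqn_modDr (b * n.-1)).
have -> : b + b * n.-1 = b * n by nia.
by rewrite (eqP dv) (eqP (dvdn_mull b l_dvd)).
Qed.

Lemma relpow_change_mod a b x :
  0 < b -> a = b %[mod l] -> relpow E a o x -> relpow E b o x.
Proof using n_ge3 E_close E_conn o_loop l_dvd l_period.
move=> b0 ab oa; apply: (@relpow_mod _ a) => //.
(* Closed walks at [o] of length [b + a * (n - 1)] exist, as this is congruent to [a * n] modulo
   [l]; the walk to [x] comes after. *)
have -> : b + a * n = (b + a * n.-1) + a by nia.
apply: relpow_cat oa; apply/l_period.
rewrite /dvdn -modnDml -ab modnDml.
have -> : a + a * n.-1 = a * n by nia.
exact: dvdn_mull.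
Qed.

Lemma adj_of_mod a b x y :
  b = a.+1 %[mod l] -> relpow E a o x -> relpow E b o y -> E x y.
Proof using n_ge3 E_close E_conn o_loop l_dvd l_period.
move=> ab /relpow_inv xo /(relpow_change_mod (ltn0Sn a) ab) oy.
apply/relpow1; apply: (@relpow_mod _ a) => //.
(* From [x] back to [o], then on to [y]: one step modulo [n]. *)
have -> : 1 + a * n = a * n.-1 + a.+1 by nia.
exact: relpow_cat xo oy.
Qed.

End ClosingRelation.

(** * Quivers *)

Definition adj (J : quiver) (x y : vert J) : Prop := exists e, edges x y e.

Lemma phi_injective_close (n : nat) (J : quiver) (x y : vert J) :
  0 < n -> phi_injective n J -> relpow (@adj J) n.-1 x y -> adj y x.
Proof.
case: n => // n _ hinj /relpowP[v [<- <- Ev]].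
have /choice[e He] : forall i : 'I_n, exists f, edges (v i) (v i.+1) f.
  by move=> i; apply: Ev.
have es (i : edge (dipath n.+1)) : src (e i) = v (val (src i)).
  by have [] := He i.
have et (i : edge (dipath n.+1)) : tgt (e i) = v (val (tgt i)).
  by have [] := He i.
have [h [hv _]] :=
  hinj (@QHom (dipath n.+1) J (fun i : 'I_n.+1 => v i) e es et).
(* [ord_max] is the one edge of the cycle outside the path; it leads from the last vertex to the
   first. *)
exists (emap h ord_max); split=> /=.
  by rewrite qhom_src; apply: (hv ord_max).
rewrite qhom_tgt -[RHS](hv ord0) /=; congr (vmap h _).
by apply: val_inj; rewrite /= modnn.
Qed.

Lemma has_walk_relpow (J : quiver) k :
  has_walk J k -> exists x y, relpow (@adj J) k x y.
Proof.
case=> v [e He]; exists (v (inord 0)), (v (inord k)); apply/relpowP.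
exists (v \o inord); split=> // i ik; exists (e (Ordinal ik)).
have := He (Ordinal ik); congr (edges (v _) (v _) _); apply: val_inj => /=;
  by rewrite inordK // ltnS // ltnW.
Qed.

Theorem theorem6p1 (n : nat) (J : quiver) (hn : 3 <= n)
    (hinj : phi_injective n J) (hconn : weakly_connected J)
    (hwalk : has_walk J (n - 1)) :
  exists l : nat, [/\ 0 < l, l %| n & is_blowup (dicycle l) J].
Proof.
have n0 : 0 < n by lia.
have close x y := @phi_injective_close n J x y n0 hinj.
have conn x y :
    clos_refl_trans (vert J) (fun u v => adj u v \/ adj v u) x y.
  elim: (hconn x y) => {x y} [x y [e [xy|yx]]|x|x y z _ IH1 _ IH2].
  - by apply: rt_step; left; exists e.
  - by apply: rt_step; right; exists e.
  - exact: rt_refl.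
  - exact: (rt_trans _ _ _ y).
have [o oo] : exists o, relpow (@adj J) n o o.
  have [x [y]] := has_walk_relpow hwalk; rewrite subn1 => xy; exists x.
  (* The given walk and its closing edge form a closed walk of length [n]. *)
  rewrite -(prednK n0) -addn1; apply: relpow_cat (xy) _.
  exact/relpow1/close.
have [l [l0 ln lP]] := period_exists hn close conn oo.
have uniq := relpow_uniq_mod hn close conn oo ln lP.
exists l; split=> //.
pose A (i : 'I_l) : set (vert J) :=
  [set x | exists2 k, relpow (@adj J) k o x & k %% l = i]%classic.
have Apart : set_partition A.
  split.
    move=> i j _ _ [x [[a oa ai] [b ob bj]]].
    by apply: val_inj; rewrite /= -ai -bj; apply: uniq oa ob.
  apply/seteqP; split=> // x _.
  have [k ok] := relpow_reach hn close conn oo x.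
  by exists (Ordinal (ltn_pmod k l0)) => //; exists k.
(* An edge of [dicycle l] is numbered by its source, so the edges of [J] are sorted by the part of
   their source. *)
exists A, (fun i => [set f | A i (src f)])%classic; split=> //.
- split.
    by move=> i j _ _ [f [Ai Aj]]; apply: Apart.1 => //; exists (src f).
  apply/seteqP; split=> // f _.
  have : (\bigcup_i A i)%classic (src f) by rewrite Apart.2.
  by case=> i _ Ai; exists i.
- move=> i f Ai; split=> //; case: Ai => k ok ki; exists k.+1.
    by rewrite -addn1; apply: relpow_cat ok _; apply/relpow1; exists f.
  by rewrite /= -ki -[(k %% l).+1]addn1 modnDml addn1.
- move=> i x y Ax [b ob bi]; have [a oa ai] := Ax.
  have [f [fx fy]] : adj x y.
    apply: (adj_of_mod hn close conn oo ln lP _ oa ob).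
    by rewrite bi /= -ai -[(a %% l).+1]addn1 modnDml addn1.
  by exists f; split=> //=; rewrite fx.
Qed.
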